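(* Fix a base $B>1$ and integers $1\le d\le m$. Let $\mathfrak{B}_0$ be a fixed $m$-dimensional box and let $\mathfrak{B}_0\supset\mathfrak{B}_1\supset\cdots$ be a linear-fragmentation process whose proportion cuts $P_1,\dots,P_m$ have probability density functions $f_i:(0,1)\to(0,\infty)$. Let $V_d^{(n)}:=\mathrm{Vol}_d(\mathfrak{B}_n)$, and let $\mathfrak{m}_d^{(n)}:=\max_{I}\prod_{i\in I}S_i^{(n)}$, the maximum over all subsets $I\subset\{1,\dots,m\}$ with $|I|=d$, where $S_1^{(n)},\dots,S_m^{(n)}$ are the side lengths of $\mathfrak{B}_n$. If the sequence $\mathfrak{m}_d^{(n)}$ converges to strong Benford behavior in base $B$, then the sequence $V_d^{(n)}$ converges to strong Benford behavior in base $B$ as $n\to\infty$.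
   Context: Significand: for $x>0$ and base $B>1$, $S_B(x)$ is the unique number in $[1,B)$ such that $\log_B x-\log_B S_B(x)$ is an integer. A sequence of positive random variables $X^{(n)}$ converges to strong Benford behavior in base $B$ if $\mathbb{P}(S_B(X^{(n)})\le D)\to\log_B D$ for every $D\in[1,B]$. An $m$-dimensional box is a set $[a_1,b_1]\times\cdots\times[a_m,b_m]\subset\mathbb{R}^m$ with finite $a_i<b_i$; its side lengths are $b_i-a_i$. For a box $\mathfrak{B}=\prod_i[a_i,b_i]$ and $1\le d\le m$, its $d$-volume is $\mathrm{Vol}_d(\mathfrak{B}):=2^{m-d}\sum_{|I|=d}\prod_{i\in I}(b_i-a_i)$, summing over all $I\subset\{1,\dots,m\}$ with $|I|=d$. A linear-fragmentation process is a sequence of random $m$-dimensional boxes $\mathfrak{B}_0\supset\mathfrak{B}_1\supset\cdots$ such that, conditionally on $\mathfrak{B}_n$, the box $\mathfrak{B}_{n+1}$ is obtained by multiplying the $i$-th side length of $\mathfrak{B}_n$ by a proportion cut, where at each step $n\ge1$ fresh independent proportion cuts $P_1^{(n)},\dots,P_m^{(n)}\in(0,1)$ are drawn, independent across $i$ and $n$, with $P_i^{(n)}$ distributed as a fixed continuous random variable $P_i$ (the same for all $n$). Thus the side lengths of $\mathfrak{B}_n$ are $S_i^{(n)}=P_i^{(0)}\prod_{t=1}^nP_i^{(t)}$, where $P_i^{(0)}$ denotes the $i$-th side length of $\mathfrak{B}_0$. It is assumed that $\log_B P_i$ has finite mean, variance and third absolute moment, and that $\mathbb{E}[\log_B P_i]=\mu_P\in\mathbb{R}$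 and $\mathrm{Var}[\log_B P_i]=\sigma_P^2>0$ are the same for all $1\le i\le m$. *)

(* Defs.v *)
From HB Require Import structures.
From mathcomp Require Import all_boot all_order all_algebra.
From mathcomp Require Import all_classical all_reals all_analysis.
From mathcomp Require Import finmap.
Set Implicit Arguments. Unset Strict Implicit. Unset Printing Implicit Defensive.
Import Order.TTheory GRing.Theory Num.Theory.
Local Open Scope classical_set_scope.
Local Open Scope ring_scope.

Definition logB {R : realType} (B x : R) : R := ln x / ln B.

(* significand S_B(x) = x / B^(floor(log_B x)), the unique number in [1,B)
   with log_B x - log_B S_B(x) an integer (for x > 0, B > 1). *)
Definition significand {R : realType} (B x : R) : R :=
  x / expR ((Num.floor (logB B x))%:~R * ln B).

Definition strong_Benford {d} {T : measurableType d} {R : realType}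
  (P : probability T R) (B : R) (X : nat -> T -> R) : Prop :=
  forall D : R, 1 <= D <= B ->
    (P [set w | significand B (X n w) <= D]) @[n --> \oo] --> (logB B D)%:E.

Definition mutually_independent {d} {T : measurableType d} {R : realType}
  (P : probability T R) {I : choiceType} (X : I -> T -> R) : Prop :=
  forall (J : {fset I}) (A : I -> set R),
    (forall i, i \in J -> measurable (A i)) ->
    P (\bigcap_(i in [set` J]) (X i @^-1` A i)) =
    (\prod_(i <- J) P (X i @^-1` A i))%E.

Definition vol_d {R : realType} (m d : nat) (s : 'I_m -> R) : R :=
  2 ^+ (m - d) * \sum_(I : {set 'I_m} | #|I| == d) \prod_(i in I) s i.

Definition max_prod_d {R : realType} (m d : nat) (s : 'I_m -> R) : R :=
  \big[Num.max/0]_(I : {set 'I_m} | #|I| == d) \prod_(i in I) s i.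

(* Main.v *)
(** The log side lengths are sums of independent terms, so for two distinct
    d-subsets the difference of the log products is a nondegenerate random walk,
    and the probability that it falls in a fixed window tends to 0.  Hence, with
    probability tending to 1, the largest product exceeds every other one by an
    arbitrarily large factor, and log_B of the d-volume is log_B of the maximum
    plus a constant plus a vanishing error.  Convergence of the fractional parts
    to the uniform law survives such a shift and such an error.

    No central limit theorem is needed for the first point: if [q] bounds the
    probability that [S] lies in a window of length [K], and the independent
    increment [U] charges each of [L] intervals, pairwise more than [K] apart,
    with mass at least [p], then the [L] translates of the window seen by [S] are
    disjoint, their probabilities sum to at most 1, and the bound for [S + U]
    drops to [q - p (L q - 1)].  Iterating gives [1 / L + (1 - p L)^n], and [L] is
    arbitrary since the law of [log P_i] has positive density on a half-line. *)
Require Import Defs.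
From HB Require Import structures.
From mathcomp Require Import all_boot all_order all_algebra.
From mathcomp Require Import all_classical all_reals all_analysis.
From mathcomp Require Import finmap.
From mathcomp Require Import measurable_realfun zify ring lra.
Set Implicit Arguments. Unset Strict Implicit. Unset Printing Implicit Defensive.
Import Order.TTheory GRing.Theory Num.Theory.
Import numFieldNormedType.Exports.
Local Open Scope classical_set_scope.
Local Open Scope ring_scope.

(** * Real-valued probabilities *)

Section RealProbability.
Context {d} {T : measurableType d} {R : realType} (P : probability T R).
Implicit Types A B E : set T.

(** Real-valued, so that the estimates below are inequalities in an ordered field rather than in the
    extended reals. *)
Definition pr A : R := fine (P A).

Lemma prE A : measurable A -> P A = (pr A)%:E.
Proof. by move=> mA; rewrite /pr fineK//; exact: fin_num_measure. Qed.

Lemma pr_ge0 A : 0 <= pr A.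
Proof. by rewrite /pr fine_ge0. Qed.

Lemma pr_setT : pr setT = 1.
Proof. by rewrite /pr probability_setT. Qed.

Lemma le_pr A B : measurable A -> measurable B -> A `<=` B -> pr A <= pr B.
Proof.
move=> mA mB AB; rewrite -lee_fin -!prE//.
by apply: le_measure => //; exact: mem_set.
Qed.

Lemma pr_le1 A : measurable A -> pr A <= 1.
Proof. by move=> mA; rewrite -pr_setT le_pr. Qed.

Lemma pr_setC A : measurable A -> pr (~` A) = 1 - pr A.
Proof.
move=> mA; have : P (~` A) = (1 - P A)%E by exact: probability_setC.
by rewrite !prE//; [move=> [->]|exact: measurableC].
Qed.

Lemma pr_setU_le A B : measurable A -> measurable B ->
  pr (A `|` B) <= pr A + pr B.
Proof.
move=> mA mB; rewrite -lee_fin EFinD -!prE//; last exact: measurableU.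
exact: measureU2.
Qed.

Lemma pr_setU A B : measurable A -> measurable B -> [disjoint A & B]%classic ->
  pr (A `|` B) = pr A + pr B.
Proof.
move=> mA mB /disj_setPS AB0; have : P (A `|` B) = (P A + P B)%E.
  by rewrite measureU//; apply/seteqP; split => // x /AB0.
by rewrite !prE//; [rewrite -EFinD => -[]|exact: measurableU].
Qed.

Lemma pr_setD A B : measurable A -> measurable B -> B `<=` A ->
  pr (A `\` B) = pr A - pr B.
Proof.
move=> mA mB BA; have mD : measurable (A `\` B) by exact: measurableD.
rewrite -[in RHS](setDUK BA) pr_setU//; first by rewrite addrC addKr.
by apply/disj_setPS => x [? []].
Qed.

Lemma pr_bigU_le (I : Type) (r : seq I) (Q : pred I) (F : I -> set T) :
  (forall i, measurable (F i)) ->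
  pr (\big[setU/set0]_(i <- r | Q i) F i) <= \sum_(i <- r | Q i) pr (F i).
Proof.
move=> mF; elim: r => [|i r IH]; first by rewrite !big_nil /pr measure0.
rewrite !big_cons; case: ifP => // _.
apply: le_trans (pr_setU_le (mF i) _) _; last by rewrite lerD2l.
exact: bigsetU_measurable.
Qed.

Lemma pr_bigU n (F : 'I_n -> set T) : (forall i, measurable (F i)) ->
  trivIset setT F -> pr (\big[setU/set0]_(i < n) F i) = \sum_(i < n) pr (F i).
Proof.
move=> mF tF; have : P (\big[setU/set0]_(i < n) F i) = (\sum_(i < n) P (F i))%E.
  exact: (measure_bigsetU_ord P xpredT).
rewrite prE; last exact: bigsetU_measurable.
by under [X in _ = X]eq_bigr do rewrite prE//; rewrite sumEFin => -[].
Qed.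

Definition independent_rv (U S : T -> R) := forall A B : set R,
  measurable A -> measurable B ->
  P (U @^-1` A `&` S @^-1` B) = (P (U @^-1` A) * P (S @^-1` B))%E.

(** Conditioning on [U]: by independence the probability is the integral, over the law of [U], of
    the probability that [S + u] lies in [I], restricted to [u] in [A]; there the integrand is at
    most [q]. *)
Lemma independent_add_le (U S : T -> R) (A I : set R) (q : R) :
  measurable_fun setT U -> measurable_fun setT S -> independent_rv U S ->
  measurable A -> measurable I -> 0 <= q ->
  (forall u, A u -> pr [set w | I (S w + u)] <= q) ->
  pr [set w | A (U w) /\ I (S w + U w)] <= q * pr (U @^-1` A).
Proof.
move=> mU mS indUS mA mI q0 leq.

pose mu : probability R R := distribution P (mfun_Sub (mem_set mU)).
pose nu : probability R R := distribution P (mfun_Sub (mem_set mS)).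
have mUS : measurable_fun setT (fun w => (U w, S w)).
  exact: measurable_fun_pair.
pose J : {measure set (R * R) -> \bar R} :=
  distribution P (mfun_Sub (mem_set mUS)).
pose C : set (R * R) := [set z | A z.1 /\ I (z.2 + z.1)].
have mC : measurable C.
  apply: measurableI; rewrite -[X in measurable X]setTI.
    exact: (measurable_fst).
  have : measurable_fun setT (fun z : R * R => z.2 + z.1).
    by apply: measurable_funD; [exact: measurable_snd|exact: measurable_fst].
  exact.
(* Independence says that the joint law [J] agrees with the product of the marginals on rectangles,
   hence on every measurable set, in particular on [C]. *)
have := @product_measure_unique _ _ R R R mu nu J indUS C mC.
rewrite /product_measure1 => JE.
have mE : measurable [set w | A (U w) /\ I (S w + U w)].
  by rewrite -[X in measurable X]setTI; exact: (mUS measurableT C mC).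
have mUA : measurable (U @^-1` A).
  by rewrite -[X in measurable X]setTI; exact: (mU measurableT A mA).
rewrite -lee_fin EFinM -!prE// -[leLHS]/(J C) -JE.
apply: (@le_trans _ _ (\int[mu]_x (q%:E * (\1_A x)%:E))%E); last first.
  rewrite ge0_integralZl_EFin//= ?integral_indic// ?setIT//.
  by apply/measurable_EFinP; exact: measurable_indic.
apply: ge0_le_integral => //.
- exact: measurable_fun_xsection.
- by apply: emeasurable_funM => //; apply/measurable_EFinP; exact: measurable_indic.
move=> u _ /=; rewrite indicE; have [uA|uA] := boolP (u \in A).
  rewrite mule1.
  have mIu : measurable [set w | I (S w + u)].
    rewrite -[X in measurable X]setTI.
    apply: (measurable_funD mS (measurable_cst u)) => //.
  rewrite (_ : distribution _ _ _ = P [set w | I (S w + u)]).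
    by rewrite prE// lee_fin leq//; exact: set_mem.
  rewrite /distribution/pushforward; congr (P _).
  apply/seteqP; split => w /=; rewrite /xsection/=; first by move=> /set_mem[].
  by move=> Iw; apply/mem_set; split => //; exact: set_mem.
rewrite mule0 (_ : xsection C u = set0) ?measure0//.
apply/seteqP; split => // s; rewrite /xsection/= => /set_mem[/= Au _].
by move: uA; rewrite mem_set.
Qed.

End RealProbability.

(** * Independence *)

Section Independence.
Context {d} {T : measurableType d} {R : realType} (P : probability T R).

Lemma independent_rv_comp (U S : T -> R) (g : R -> R) :
  measurable_fun setT g -> independent_rv P U S -> independent_rv P (g \o U) S.
Proof.
move=> mg US A B mA mB; rewrite comp_preimage US//.
by rewrite -[X in measurable X]setTI; exact: mg.
Qed.

Context {I : choiceType} (X : I -> T -> R).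
Hypothesis mX : forall i, measurable_fun setT (X i).

(** The finite-dimensional cylinders over indices other than [k]: a pi-system generating the
    sigma-algebra of all the other coordinates. *)
Definition rectangles_off (k : I) : set (set T) :=
  [set E | exists (J : {fset I}) (A : I -> set R),
    [/\ k \notin J, forall i, measurable (A i) &
        E = \bigcap_(i in [set` J]) (X i @^-1` A i)]].

Lemma rectangles_off_setI k : setI_closed (rectangles_off k).
Proof.
move=> _ _ [J1 [A1 [kJ1 mA1 ->]]] [J2 [A2 [kJ2 mA2 ->]]].
exists (J1 `|` J2)%fset, (fun i =>
  (if i \in J1 then A1 i else setT) `&` (if i \in J2 then A2 i else setT)).
split=> [|i|]; first by rewrite in_fsetU negb_or kJ1.
  by apply: measurableI; case: ifP.
apply/seteqP; split=> w /=.
  move=> [w1 w2] i _; split; case: ifP => // iJ; [exact: w1|exact: w2].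
move=> H; split=> i /= iJ; have := H i; rewrite /= in_fsetU iJ ?orbT => /(_ isT)[] //.
Qed.

Lemma rectangles_off_measurable k : rectangles_off k `<=` measurable.
Proof.
move=> _ [J [A [_ mA ->]]]; apply: fin_bigcap_measurable; first exact: finite_fset.
by move=> i _; rewrite -[X in measurable X]setTI; exact: mX.
Qed.

Lemma rectangles_off_setT k : rectangles_off k setT.
Proof.
exists fset0, (fun=> setT); split=> //.
by apply/seteqP; split=> // w _ i.
Qed.

Hypothesis indX : mutually_independent P X.

(** Intersecting with a constraint on the fresh index [k] gives a cylinder over [k] and [J], and the
    product formula applies to both cylinders. *)
Lemma independent_rectangles_off k (A : set R) (E : set T) :
  measurable A -> rectangles_off k E ->
  P (X k @^-1` A `&` E) = (P (X k @^-1` A) * P E)%E.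
Proof.
move=> mA [J [B [kJ mB ->]]].
rewrite (indX (J := J) (A := B))//.
pose A' i := if i == k then A else B i.
transitivity (P (\bigcap_(i in [set` (k |` J)%fset]) (X i @^-1` A' i))).
  congr (P _); apply/seteqP; split=> w /=.
    move=> [wA wB] i /=; rewrite /A' in_fset1U; case: eqP => [->//|_] /=.
    exact: wB.
  move=> H; split; first by have := H k; rewrite /A' /= in_fset1U eqxx; exact.
  move=> i /= iJ; have := H i; rewrite /A' /= in_fset1U iJ orbT => /(_ isT).
  by case: eqP => // ik; move: kJ; rewrite -ik iJ.
rewrite indX; last by move=> i _; rewrite /A'; case: ifP.
rewrite big_fsetU1//= /A' eqxx; congr (_ * _)%E.
rewrite big_seq [RHS]big_seq; apply: eq_bigr => i iJ.
by case: eqP => // ik; move: kJ; rewrite -ik iJ.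
Qed.

(** Expresses that [S] is a function of the coordinates other than [k], without naming such a
    function. *)
Definition measurable_off (k : I) (S : T -> R) :=
  measurable_fun [set: g_sigma_algebraType (rectangles_off k)] S.

Lemma measurable_off_coord k i : i != k -> measurable_off k (X i).
Proof.
move=> ik _ A mA; rewrite setTI; apply: sub_gen_smallest.
exists [fset i]%fset, (fun=> A); split=> //; first by rewrite in_fset1 eq_sym.
apply/seteqP; split=> w /=; first by move=> wA j /=; rewrite in_fset1 => /eqP ->.
by apply; rewrite /= in_fset1.
Qed.

Lemma measurable_off_measurable k S : measurable_off k S -> measurable_fun setT S.
Proof.
move=> mS _ A mA; have := mS measurableT A mA.
apply: smallest_sub; first exact: sigma_algebra_measurable.
exact: rectangles_off_measurable.
Qed.

(** Pi-lambda argument: with [E] the event about [X k], the finite measures [P (E & C)] and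
    [P E * P C] of [C] agree on the pi-system of cylinders off [k], hence on the sigma-algebra that
    it generates. *)
Lemma independent_off k S : measurable_off k S -> independent_rv P (X k) S.
Proof.
move=> mS A B mA mB; set E := X k @^-1` A.
have mE : measurable E by rewrite -[X in measurable X]setTI; exact: mX.
pose m1 : {measure set T -> \bar R} := mrestr P mE.
pose m2 : {measure set T -> \bar R} := mscale (NngNum (pr_ge0 P E)) P.
have cov : \bigcup_(n in [set: nat]) [set: T] = setT.
  by apply/seteqP; split=> // w _; exists 0%N.
have m12 C : rectangles_off k C -> m1 C = m2 C.
  move=> kC; rewrite /m1 /m2 /= /mrestr /mscale /= setIC.
  by rewrite independent_rectangles_off// -/E -prE.
have m1fin (n : nat) : (m1 [set: T] < +oo)%E.
  by rewrite /m1 /= /mrestr setTI (le_lt_trans (probability_le1 P mE)) ?ltry.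
have := @g_sigma_algebra_measure_unique _ _ _ (rectangles_off k)
  (@rectangles_off_measurable k) (fun=> setT) (fun=> @rectangles_off_setT k)
  cov m1 m2 (@rectangles_off_setI k) m12 m1fin (S @^-1` B).
rewrite /m1 /m2 /= /mrestr /mscale /= setIC -/E -prE//; apply.
by have := mS measurableT B mB; rewrite setTI.
Qed.

End Independence.

(** * Concentration of sums *)

Section Concentration.
Context {d} {T : measurableType d} {R : realType} (P : probability T R).

Lemma measurable_preimage_itv (S : T -> R) (i : interval R) :
  measurable_fun setT S -> measurable (S @^-1` [set` i]).
Proof. by move=> mS; rewrite -[X in measurable X]setTI; exact: mS. Qed.

(** The Lévy concentration function of [S] at scale [K] is at most [q]. *)
Definition concentrated (K : R) (S : T -> R) (q : R) :=
  forall x, pr P (S @^-1` `[x, x + K]) <= q.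

(* Any two distinct cells are at distance at least [2 * K]. *)
Definition cell (K : R) (l : nat) : set R :=
  `[- (3 * l%:R + 2) * K, - (3 * l%:R + 1) * K].

Lemma cell_disjoint K l l' : 0 < K -> (l < l')%N -> cell K l `&` cell K l' = set0.
Proof.
move=> K0 ll'; apply/seteqP; split => // u [].
rewrite /cell/= !in_itv/= => /andP[h1 _] /andP[_ h2].
have : (l%:R + 1 : R) <= l'%:R by rewrite natr1 ler_nat.
nra.
Qed.

(** The event is split according to the cell that contains [U]. Seen from [S], the cells give
    disjoint windows, so the masses [b l] sum to at most 1 and cannot all be close to [q] when
    [L * q] exceeds 1. *)
Lemma concentrated_add (K q p : R) (L : nat) (U S : T -> R) :
  0 < K -> 0 <= q -> 0 <= p ->
  measurable_fun setT U -> measurable_fun setT S -> independent_rv P U S ->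
  (forall l : 'I_L, p <= pr P (U @^-1` cell K l)) ->
  concentrated K S q ->
  concentrated K (fun w => S w + U w) (q - p * (L%:R * q - 1)).
Proof.
move=> K0 q0 p0 mU mS US pU Sq x.
pose I : set R := `[x, x + K]%classic.
pose a (l : 'I_L) := pr P (U @^-1` cell K l).
(* All values of [S] compatible with [S + U] in [[x, x + K]] and [U] in cell [l]. The length is
   [2 * K], and the spacing of the cells leaves a gap of [K] between consecutive windows. *)
pose win (l : 'I_L) : interval R := `[x + (3 * l%:R + 1) * K, x + (3 * l%:R + 3) * K].
pose b (l : 'I_L) := pr P (S @^-1` [set` win l]).
have mSU : measurable_fun setT (fun w => S w + U w) by exact: measurable_funD.
have mcell (l : nat) : measurable (cell K l) by exact: measurable_itv.
have mUcell (l : 'I_L) : measurable (U @^-1` cell K l) by exact: measurable_preimage_itv.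
have le_pE (A : set R) r : measurable A -> 0 <= r ->
    (forall u, A u -> pr P [set w | I (S w + u)] <= r) ->
    pr P (U @^-1` A `&` [set w | I (S w + U w)]) <= r * pr P (U @^-1` A).
  by move=> mA r0 Ar; exact: (independent_add_le mU mS US mA (measurable_itv _) r0 Ar).
have lq u : pr P [set w | I (S w + u)] <= q.
  rewrite (_ : [set w | _] = S @^-1` `[x - u, x - u + K])//.
  by apply/seteqP; split=> w; rewrite /I/= !in_itv/= => /andP[? ?]; apply/andP; split; lra.
pose F (l : 'I_L) := U @^-1` cell K l `&` [set w | I (S w + U w)].
have mI : measurable [set w | I (S w + U w)] by exact: (measurable_preimage_itv _ mSU).
(* Conditioning on [U] bounds this probability by both [q * a l] and [b l * a l]. If [q <= b l], the
   first suffices; otherwise [b l * a l = q * a l - a l * (q - b l)] and [p <= a l]. *)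
have leF l : pr P (F l) <= q * a l - p * (q - b l).
  have [qb|bq] := leP q (b l).
    apply: (le_trans (le_pE _ q (mcell l) q0 _)) => //; rewrite -/(a l); nra.
  have lb u : cell K l u -> pr P [set w | I (S w + u)] <= b l.
    rewrite /cell /= in_itv/= => /andP[u1 u2].
    apply: le_pr; [|exact: measurable_preimage_itv|].
      have mSu : measurable_fun setT (fun w => S w + u) by exact: measurable_funD.
      exact: (measurable_preimage_itv _ mSu).
    by move=> w; rewrite /I /= !in_itv/= => /andP[h1 h2]; apply/andP; split; nra.
  apply: (le_trans (le_pE _ _ (mcell l) (pr_ge0 _ _) lb)); rewrite -/(a l) -/(b l).
  have qb : 0 <= q - b l by rewrite subr_ge0 ltW.
  have pa : 0 <= a l - p by rewrite subr_ge0; exact: pU.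
  have := mulr_ge0 pa qb; nra.
have Sb : \sum_(l < L) b l <= 1.
  rewrite -pr_bigU; [|by move=> l; exact: measurable_preimage_itv|].
    by apply: pr_le1; apply: bigsetU_measurable => l _; exact: measurable_preimage_itv.
  apply/trivIsetP => l l' _ _; rewrite -(inj_eq val_inj) neq_ltn => ll'.
  have dis (i j : 'I_L) : (i < j)%N -> S @^-1` [set` win i] `&` S @^-1` [set` win j] = set0.
    move=> ij; apply/seteqP; split=> // w [] /=; rewrite !in_itv/= => /andP[_ h1] /andP[h2 _].
    have : (i%:R + 1 : R) <= j%:R by rewrite natr1 ler_nat.
    nra.
  by case/orP: ll' => ?; [|rewrite setIC]; exact: dis.
pose A := \big[setU/set0]_(l < L) cell K l.
have mA : measurable A by exact: bigsetU_measurable.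
have UA : U @^-1` A = \big[setU/set0]_(l < L) (U @^-1` cell K l).
  by rewrite /A; elim/big_ind2 : _ => // ? ? ? ? <- <-; exact: preimage_setU.
have mUA : measurable (U @^-1` A) by rewrite UA; exact: bigsetU_measurable.
have prA : pr P (U @^-1` (~` A)) = 1 - \sum_(l < L) a l.
  rewrite -preimage_setC pr_setC// UA pr_bigU//.
  apply/trivIsetP => l l' _ _; rewrite -(inj_eq val_inj) neq_ltn -preimage_setI.
  by case/orP => ?; [|rewrite setIC]; rewrite cell_disjoint// preimage_set0.
have leA : pr P (U @^-1` (~` A) `&` [set w | I (S w + U w)]) <= q * (1 - \sum_(l < L) a l).
  by rewrite -prA; apply: le_pE => //; exact: measurableC.
have mF l : measurable (F l) by exact: measurableI.
have cover : (fun w => S w + U w) @^-1` I `<=`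
    \big[setU/set0]_(l < L) F l `|` (U @^-1` (~` A) `&` [set w | I (S w + U w)]).
  move=> w /= Iw; have [Aw|Aw] := pselect (A (U w)); last by right.
  left; have : (U @^-1` A) w by [].
  rewrite UA -!bigcup_seq => -[l /= lL lw].
  by exists l.
have mE : measurable (U @^-1` (~` A) `&` [set w | I (S w + U w)]).
  by apply: measurableI => //; rewrite -preimage_setC; exact: measurableC.
have mFs : measurable (\big[setU/set0]_(l < L) F l) by exact: bigsetU_measurable.
apply: (le_trans (le_pr P mI (measurableU _ _ mFs mE) cover)).
apply: (le_trans (pr_setU_le P mFs mE)).
apply: (le_trans (lerD (pr_bigU_le P _ _ mF) leA)).
(* Summed over the cells, the terms [q * a l] combine with [q * (1 - \sum a l)] from the complement
   to give exactly [q]; what remains is the gain, estimated with [Sb]. *)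
have : \sum_(l < L) pr P (F l) <= q * (\sum_(l < L) a l) - p * (L%:R * q - \sum_(l < L) b l).
  apply: (le_trans (ler_sum _ (fun l _ => leF l))).
  rewrite sumrB -!mulr_sumr sumrB sumr_const card_ord.
  by rewrite -[q *+ L]mulr_natl.
nra.
Qed.

End Concentration.

(** * Random walks with independent logarithmic increments *)

Section Walk.
Context {d} {T : measurableType d} {R : realType} (P : probability T R).
Context {I : choiceType} (X : I -> T -> R).
Hypothesis mX : forall i, measurable_fun setT (X i).
Hypothesis indX : mutually_independent P X.
Variable k : nat -> I.
Hypothesis k_inj : injective k.

(** [k] enumerates the coordinates that drive the walk; [S] gathers all contributions of the other
    coordinates. *)
Let walk (S : T -> R) n w := S w + \sum_(t < n) ln (X (k t) w).

(** The first [n] increments use the indices [k t] with [t < n], all different from [k n] by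
    injectivity. This makes the next increment independent of the current position. *)
Lemma walk_measurable_off (S : T -> R) n :
  measurable_off X (k n) S -> measurable_off X (k n) (walk S n).
Proof.
move=> mS; apply: measurable_funD => //.
have mln t : k t != k n -> measurable_off X (k n) (fun w => ln (X (k t) w)).
  move=> tn; apply: (measurableT_comp (@measurable_ln R)).
  exact: measurable_off_coord.
have {mln} mln (t : 'I_n) : measurable_off X (k n) (fun w => ln (X (k t) w)).
  by apply: mln; rewrite (inj_eq k_inj) neq_ltn ltn_ord.
exact: (measurable_sum (index_enum 'I_n) mln).
Qed.

Lemma concentrated_walk (K p : R) (L n : nat) (S : T -> R) :
  0 < K -> 0 <= p -> p * L%:R <= 1 -> (0 < L)%N ->
  (forall t (l : 'I_L), p <= pr P ((fun w => ln (X (k t) w)) @^-1` cell K l)) ->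
  (forall t, measurable_off X (k t) S) ->
  concentrated P K (walk S n) (L%:R^-1 + (1 - p * L%:R) ^+ n).
Proof.
move=> K0 p0 pL L0 pX mS.
have L0' : 0 < L%:R :> R by rewrite ltr0n.
have mS' := measurable_off_measurable mX (mS 0%N).
elim: n => [|n IH].
  move=> x; rewrite expr0; apply: (@le_trans _ _ 1); last by rewrite lerDr invr_ge0 ltW.
  apply: pr_le1; apply: measurable_preimage_itv.
  rewrite /walk; under eq_fun do rewrite big_ord0 addr0.
  exact: mS'.
have mw := measurable_off_measurable mX (walk_measurable_off (mS n)).
set q := (X in concentrated _ _ _ X) in IH.
have q0 : 0 <= q by rewrite addr_ge0 ?invr_ge0 ?(ltW L0')// exprn_ge0// subr_ge0.
have := concentrated_add K0 q0 p0 (measurableT_comp (@measurable_ln R) (mX (k n))) mw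
  (independent_rv_comp (@measurable_ln R)
    (independent_off mX indX (walk_measurable_off (mS n))))
  (pX n) IH.
(* The map [q - p * (L * q - 1)] is affine with fixed point [1 / L] and slope [1 - p * L], so the
   excess over [1 / L] is multiplied by that slope. *)
rewrite (_ : q - _ = L%:R^-1 + (1 - p * L%:R) ^+ n.+1); last first.
  rewrite /q exprS; move: (_ ^+ n) => z; field; exact: lt0r_neq0.
rewrite (_ : (fun w => _ + _) = walk S n.+1)//; apply/funext => w.
by rewrite /walk big_ord_recr/= addrA.
Qed.

(** First [L] makes [1 / L] small, then [n] makes the geometric term small. The threshold for [n] is
    uniform in [S], which allows a starting term that itself changes with [n]. *)
Lemma concentrated_walk_small (K : R) : 0 < K ->
  (forall l, exists2 p : R, 0 < p &
     forall t, p <= pr P ((fun w => ln (X (k t) w)) @^-1` cell K l)) ->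
  forall e : R, 0 < e -> \forall n \near \oo, forall S,
    (forall t, measurable_off X (k t) S) -> concentrated P K (walk S n) e.
Proof.
move=> K0 pX e e0.
have [L L0 Le] : exists2 L : nat, (0 < L)%N & L%:R^-1 <= e / 2.
  have e20 : 0 < e / 2 by rewrite divr_gt0.
  have bound_e : (e / 2)^-1 < (Num.bound (e / 2)^-1)%:R.
    by rewrite archi_boundP// invr_ge0 ltW.
  have bound0 : 0 < (Num.bound (e / 2)^-1)%:R :> R.
    by apply: lt_trans bound_e; rewrite invr_gt0.
  exists (Num.bound (e / 2)^-1); first by rewrite -(ltr_nat R).
  by rewrite invf_ple ?posrE// ltW.
have [p p0 [pL pX']] : exists2 p : R, 0 < p & p * L%:R <= 1 /\ (forall t (l : 'I_L),
    p <= pr P ((fun w => ln (X (k t) w)) @^-1` cell K l)).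
  have [pl pl0 Hpl] : exists2 pl : nat -> R, (forall l, 0 < pl l) & forall l t,
      pl l <= pr P ((fun w => ln (X (k t) w)) @^-1` cell K l).
    have [pl Hpl] := choice (fun l => let: ex_intro2 p p0 Hp := pX l in ex_intro
      (fun p => 0 < p /\ forall t, p <= pr P ((fun w => ln (X (k t) w)) @^-1` cell K l))
      p (conj p0 Hp)).
    by exists pl => l; have [] := Hpl l.
  (* Starting the minimum at [1 / L] ensures [p * L <= 1]. *)
  exists (\big[Num.min/L%:R^-1]_(l < L) pl l).
    by apply: lt_bigmin => //; rewrite invr_gt0 ltr0n.
  split=> [|t l]; last by apply: le_trans (Hpl l t); apply: (@bigmin_inf _ _ _ _ l).
  by rewrite -ler_pdivlMr ?ltr0n// mul1r; exact: bigmin_le_id.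
have : (1 - p * L%:R) ^+ n @[n --> \oo] --> 0.
  apply: cvg_expr; rewrite ger0_norm ?subr_ge0//.
  by rewrite ltrBlDr ltrDl mulr_gt0// ltr0n.
have e20 : 0 < e / 2 by rewrite divr_gt0.
move=> /cvgrPdist_le /(_ (e / 2) e20) H.
near=> n => S mS x; apply: le_trans (concentrated_walk n K0 (ltW p0) pL L0 pX' mS x) _.
rewrite [leRHS]splitr lerD//.
have : `|0 - (1 - p * L%:R) ^+ n| <= e / 2 by near: n.
by rewrite sub0r normrN; apply: le_trans; exact: ler_norm.
Unshelve. all: by end_near.
Qed.

End Walk.

(** * Mass that the logarithm of a proportion cut gives to the cells *)

Section LogCells.
Context {d} {T : measurableType d} {R : realType} (P : probability T R).

(** If the integral vanished, [f] would be zero almost everywhere on [[a, b]]; since [f] is positive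
    there, [[a, b]] would be a null set, against its length [b - a > 0]. *)
Lemma integral_pos_gt0 (f : R -> R) (a b : R) :
  measurable_fun (`]0%R, 1%R[%classic : set R) f ->
  (forall x, 0 < x < 1 -> 0 < f x) -> 0 < a -> a < b -> b < 1 ->
  (0 < \int[@lebesgue_measure R]_(x in `[a, b] `&` `]0%R, 1%R[) (f x)%:E)%E.
Proof.
move=> mf f0 a0 ab b1.
have sub : `[a, b] `<=` (`]0, 1[%classic : set R).
  by move=> x /=; rewrite !in_itv/= => /andP[? ?]; apply/andP; split; lra.
rewrite (_ : _ `&` _ = `[a, b]%classic); last exact/setIidPl.
have fpos x : `[a, b]%classic x -> 0 < f x by move=> /sub /=; rewrite in_itv/=; exact: f0.
have mfE : measurable_fun `[a, b] (EFin \o f).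
  by apply/measurable_EFinP; exact: measurable_funS mf.
rewrite lt0e integral_ge0 ?andbT; last by move=> x /fpos ?; rewrite lee_fin ltW.
apply/eqP => int0.
have abs0 : (\int[@lebesgue_measure R]_(x in `[a, b]) `|(EFin \o f) x| = 0)%E.
  rewrite -[RHS]int0; apply: eq_integral => x /set_mem/fpos fx.
  by rewrite gee0_abs// lee_fin ltW.
have [N [mN N0 sN]] :=
  (ae_eq_integral_abs (@lebesgue_measure R) (measurable_itv _) mfE).1 abs0.
have abN : `[a, b] `<=` N.
  move=> x abx; apply: sN => /= /(_ abx) [] fx0.
  by have := fpos _ abx; rewrite fx0 ltxx.
have : (@lebesgue_measure R `[a, b] <= @lebesgue_measure R N)%E.
  by apply: le_measure => //; apply: mem_set => //; exact: measurable_itv.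
rewrite [leRHS]N0 lebesgue_measure_itv/= lte_fin ab -EFinB lee_fin; lra.
Qed.

(** The exponential maps a cell, which lies in the negative half-line, onto a compact interval
    inside [(0, 1)], where the density is positive. One [p] serves every [t] because all the [X t]
    have the same law. *)
Lemma log_cell_prob (X : nat -> T -> R) (f : R -> R) (K : R) (l : nat) :
  0 < K -> (forall t, measurable_fun setT (X t)) -> (forall t w, 0 < X t w) ->
  measurable_fun (`]0%R, 1%R[%classic : set R) f ->
  (forall x, 0 < x < 1 -> 0 < f x) ->
  (forall t (A : set R), measurable A -> P (X t @^-1` A) =
     (\int[@lebesgue_measure R]_(x in A `&` (`]0%R, 1%R[%classic : set R)) (f x)%:E)%E) ->
  exists2 p : R, 0 < p & forall t, p <= pr P ((fun w => ln (X t w)) @^-1` cell K l).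
Proof.
move=> K0 mX X0 mf f0 Xf.
pose a := expR (- (3 * l%:R + 2) * K); pose b := expR (- (3 * l%:R + 1) * K).
have l0 : 0 <= l%:R :> R by [].
have cellE t : (fun w => ln (X t w)) @^-1` cell K l = X t @^-1` `[a, b].
  by apply/seteqP; split=> w; rewrite /cell/= !in_itv/= /a /b -(ler_ln _ (X0 t w))
    ?posrE ?expR_gt0// -(ler_ln (X0 t w)) ?posrE ?expR_gt0// !expRK.
have prX t : P (X t @^-1` `[a, b]) = _ := Xf t _ (measurable_itv _).
have : (0 < P (X 0%N @^-1` `[a, b]))%E.
  rewrite prX; apply: integral_pos_gt0 => //; first exact: expR_gt0.
    by rewrite ltr_expR; nra.
  by rewrite -expR0 ltr_expR; nra.
move=> p0; exists (pr P (X 0%N @^-1` `[a, b])).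
  by rewrite -lte_fin -prE//; exact: measurable_preimage_itv.
by move=> t; rewrite cellE /pr !prX.
Qed.

End LogCells.

(** * Uniform distribution modulo one *)

Section BenfordModOne.
Context {d} {T : measurableType d} {R : realType} (P : probability T R).

Definition fracpart (y : R) : R := y - (Num.floor y)%:~R.

Lemma fracpart_itv y : 0 <= fracpart y < 1.
Proof. have := floor_itv y; rewrite /fracpart intrD => /andP[]; lra. Qed.

Lemma measurable_fracpart : measurable_fun setT fracpart.
Proof.
apply: measurable_funB => //; apply: nondecreasing_measurable => // x y xy.
by rewrite ler_int le_floor.
Qed.

Definition uniform_mod1 (Y : nat -> T -> R) := forall s, 0 <= s <= 1 ->
  pr P [set w | fracpart (Y n w) <= s] @[n --> \oo] --> s.

Lemma measurable_fracpart_le (Y : T -> R) s : measurable_fun setT Y ->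
  measurable [set w | fracpart (Y w) <= s].
Proof.
move=> mY; have mF : measurable_fun setT (fun w => fracpart (Y w)).
  exact: (measurableT_comp measurable_fracpart).
rewrite (_ : [set w | _] = (fun w => fracpart (Y w)) @^-1` `]-oo, s]).
  by rewrite -[X in measurable X]setTI; exact: mF.
by apply/seteqP; split=> w /=; rewrite in_itv.
Qed.

(** Extends the limit to thresholds outside [[0, 1]], which arise when an arc is shifted or wraps
    around. *)
Lemma uniform_mod1_clamp (Y : nat -> T -> R) s : uniform_mod1 Y ->
  pr P [set w | fracpart (Y n w) <= s] @[n --> \oo] --> Num.min 1 (Num.max 0 s).
Proof.
move=> uY; have [s0|s0] := ltP s 0.
  rewrite min_r// (_ : (fun n => _) = fun=> 0); first exact: cvg_cst.
  apply/funext => n; rewrite (_ : [set w | _] = set0) ?/pr ?measure0//.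
  apply/seteqP; split=> // w /=; have /andP[] := fracpart_itv (Y n w); lra.
have [s1|s1] := leP s 1; first by apply: uY; rewrite s0.
rewrite (_ : (fun n => _) = fun=> 1); first exact: cvg_cst.
apply/funext => n; rewrite (_ : [set w | _] = setT) ?pr_setT//.
apply/seteqP; split=> // w _ /=; have /andP[] := fracpart_itv (Y n w); lra.
Qed.

(** Upper bound for an arc of the circle of length [v - u], uniform over the events contained in it.
    After translation its left end lies in [[0, 1)], and a part beyond 1 wraps around to the
    fractional parts at most [v0 - 1]. *)
Lemma uniform_mod1_le (Y : nat -> T -> R) (u v e : R) :
  (forall n, measurable_fun setT (Y n)) -> uniform_mod1 Y -> u <= v -> 0 < e ->
  \forall n \near \oo, forall E, measurable E ->
    (forall w, E w -> exists k : int, u <= Y n w + k%:~R <= v) -> pr P E <= v - u + e.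
Proof.
move=> mY uY uv e0.
have [uv1|vu1] := leP (u + 1) v.
  by near=> n => E mE _; apply: (le_trans (pr_le1 P mE)); lra.
pose u0 := fracpart u; pose v0 := v - (Num.floor u)%:~R.
have /andP[u00 u01] : 0 <= u0 < 1 by exact: fracpart_itv.
have uv0 : v0 - u0 = v - u by rewrite /v0 /u0 /fracpart; ring.
have e8 : 0 < e / 8 by rewrite divr_gt0.
have /cvgrPdist_le/(_ _ e8) H1 := uniform_mod1_clamp (s := v0) uY.
have /cvgrPdist_le/(_ _ e8) H2 := uniform_mod1_clamp (s := u0 - e / 4) uY.
have /cvgrPdist_le/(_ _ e8) H3 := uniform_mod1_clamp (s := v0 - 1) uY.
near=> n.
have h1 : `|Num.min 1 (Num.max 0 v0) - pr P [set w | fracpart (Y n w) <= v0]| <= e / 8.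
  by near: n.
have h2 : `|Num.min 1 (Num.max 0 (u0 - e / 4))
    - pr P [set w | fracpart (Y n w) <= u0 - e / 4]| <= e / 8.
  by near: n.
have h3 : `|Num.min 1 (Num.max 0 (v0 - 1))
    - pr P [set w | fracpart (Y n w) <= v0 - 1]| <= e / 8.
  by near: n.
move=> E mE EY.
pose F s := [set w | fracpart (Y n w) <= s].
have mF s : measurable (F s) by exact: measurable_fracpart_le.
(* Removing [F u0] would lose the left endpoint, since the events [F s] are closed on the right;
   hence the slack [e / 4]. With the three errors [e / 8] the total stays below [e]. *)
have EF : E `<=` (F v0 `\` F (u0 - e / 4)) `|` F (v0 - 1).
  move=> w /EY[k /andP[k1 k2]]; rewrite /F /=.
  have /andP[f0 f1] := fracpart_itv (Y n w).
  pose j := (k + Num.floor (Y n w) - Num.floor u)%R.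
  have jE : fracpart (Y n w) + j%:~R = Y n w + k%:~R - (Num.floor u)%:~R.
    by rewrite /j /fracpart rmorphB rmorphD/=; ring.
  have j1 : u0 <= fracpart (Y n w) + j%:~R by rewrite jE /u0 /fracpart; lra.
  have j2 : fracpart (Y n w) + j%:~R <= v0 by rewrite jE /v0; lra.
  have j3 : (-1 < j)%R by rewrite -(ltr_int R); lra.
  have j4 : (j < 2)%R by rewrite -(ltr_int R); lra.
  (* [j = 0] is the part of the arc before 1, [j = 1] the part that has wrapped around. *)
  have [j0|j0] : j = 0 \/ j = 1 by clear -j3 j4; move: (j) j3 j4 => i; lia.
    left; split; first by move: j2; rewrite j0 addr0.
    by apply/negP; rewrite -ltNge; move: j1; rewrite j0; lra.
  by right; move: j2; rewrite j0; lra.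
have mD : measurable (F v0 `\` F (u0 - e / 4)) by exact: measurableD.
apply: (le_trans (le_pr P mE (measurableU _ _ mD (mF _)) EF)).
apply: (le_trans (pr_setU_le P mD (mF _))).
rewrite pr_setD//; last by move=> w; rewrite /F /=; lra.
have m1 : Num.min 1 (Num.max 0 v0) + Num.min 1 (Num.max 0 (v0 - 1)) <= v0.
  have v00 : 0 <= v0 by lra.
  rewrite (max_r v00); have [v1|v1] := leP v0 1.
    by rewrite max_l ?subr_le0// (min_r ler01) addr0.
  have [v2 v2'] : v0 - 1 <= 1 /\ 0 <= v0 - 1 by split; lra.
  by rewrite (max_r v2') (min_r v2); lra.
have m2 : u0 - e / 4 <= Num.min 1 (Num.max 0 (u0 - e / 4)).
  by rewrite le_min le_max lexx orbT andbT; lra.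
move: h1 h2 h3; rewrite -/(F v0) -/(F (u0 - e / 4)) -/(F (v0 - 1)) !ler_norml.
move=> /andP[? ?] /andP[? ?] /andP[? ?].
lra.
Unshelve. all: by end_near.
Qed.

(** Upper bounds suffice: applied to the complementary arcs [[0, s]] and [[s, 1]], they control the
    probability from above and from below. *)
Lemma uniform_mod1_perturb (Y Z : nat -> T -> R) (a : R) :
  (forall n, measurable_fun setT (Y n)) -> (forall n, measurable_fun setT (Z n)) ->
  (forall dl e, 0 < dl -> 0 < e -> \forall n \near \oo, exists G, [/\ measurable G,
     pr P (~` G) <= e & forall w, G w -> 0 <= Z n w - Y n w - a <= dl]) ->
  uniform_mod1 Y -> uniform_mod1 Z.
Proof.
move=> mY mZ YZ uY s /andP[s0 s1]; apply/cvgrPdist_le => e e0.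
have e3 : 0 < e / 3 by rewrite divr_gt0.
(* On [G], if [Z] is in [[x, y]] modulo 1, then [Y] is in [[x - a - e / 3, y - a]] modulo 1. The
   three thirds of [e] pay for this widening, the error of the arc bound and the complement of
   [G]. *)
have bound x y : x <= y -> \forall n \near \oo, forall E, measurable E ->
    (forall w, E w -> x <= fracpart (Z n w) <= y) -> pr P E <= y - x + e.
  move=> xy.
  have xy' : x - a - e / 3 <= y - a by lra.
  have U := uniform_mod1_le mY uY xy' e3.
  near=> n => E mE EZ.
  have [G [mG PG GZ]] : exists G, [/\ measurable G,
     pr P (~` G) <= e / 3 & forall w, G w -> 0 <= Z n w - Y n w - a <= e / 3].
    by near: n; exact: YZ.
  have mEG : measurable (E `&` G) by exact: measurableI.
  have mGC : measurable (~` G) by exact: measurableC.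
  have EG : E `<=` (E `&` G) `|` ~` G.
    by move=> w Ew; have [?|?] := pselect (G w); [left|right].
  apply: (le_trans (le_pr P mE (measurableU _ _ mEG mGC) EG)).
  apply: (le_trans (pr_setU_le P mEG mGC)).
  have UE : forall F, measurable F ->
      (forall w, F w -> exists k : int, x - a - e / 3 <= Y n w + k%:~R <= y - a) ->
      pr P F <= y - a - (x - a - e / 3) + e / 3 by near: n; exact: U.
  have := UE _ mEG; suff Hk : forall w, (E `&` G) w ->
      exists k : int, x - a - e / 3 <= Y n w + k%:~R <= y - a.
    by move=> /(_ Hk); lra.
  move=> w [/EZ/andP[z1 z2] /GZ/andP[g1 g2]]; exists (- Num.floor (Z n w)).
  by move: z1 z2; rewrite /fracpart rmorphN/= => z1 z2; apply/andP; split; lra.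
have Hs := bound _ _ s0; have Hs' := bound _ _ s1.
near=> n.
have mE : measurable [set w | fracpart (Z n w) <= s] by exact: measurable_fracpart_le.
have Us : forall E, measurable E -> (forall w, E w -> 0 <= fracpart (Z n w) <= s) ->
  pr P E <= s - 0 + e by near: n.
have Us' : forall E, measurable E -> (forall w, E w -> s <= fracpart (Z n w) <= 1) ->
  pr P E <= 1 - s + e by near: n.
have := Us _ mE; have := Us' _ (measurableC mE); rewrite pr_setC// => H1 H2.
rewrite ler_norml; apply/andP; split.
  suff : pr P [set w | fracpart (Z n w) <= s] <= s - 0 + e by lra.
  by apply: H2 => w /= ->; rewrite andbT; have /andP[] := fracpart_itv (Z n w).
suff : 1 - pr P [set w | fracpart (Z n w) <= s] <= 1 - s + e by lra.
apply: H1 => w /= /negP; rewrite -ltNge => /ltW -> /=.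
by have /andP[_ /ltW] := fracpart_itv (Z n w).
Unshelve. all: by end_near.
Qed.

(** The base-[B] logarithm of the significand is the fractional part of [logB B x]. *)
Lemma significand_le (B x D : R) : 1 < B -> 0 < x -> 0 < D ->
  (significand B x <= D) = (fracpart (logB B x) <= logB B D).
Proof.
move=> B1 x0 D0; have lnB : 0 < ln B by exact: ln_gt0.
rewrite /significand ler_pdivrMr ?expR_gt0// -[LHS]ler_ln ?posrE ?mulr_gt0 ?expR_gt0//.
rewrite lnM ?posrE ?expR_gt0// expRK -lerBlDr /fracpart [in RHS]/logB.
by rewrite ler_pdivlMr// mulrBl divfK ?gt_eqF.
Qed.

Lemma strong_Benford_uniform (B : R) (X : nat -> T -> R) : 1 < B ->
  (forall n w, 0 < X n w) -> (forall n, measurable_fun setT (X n)) ->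
  strong_Benford P B X <-> uniform_mod1 (fun n w => logB B (X n w)).
Proof.
move=> B1 X0 mX; have B0 : 0 < B by rewrite (lt_trans _ B1).
have lnB : 0 < ln B by exact: ln_gt0.
have mlogX n : measurable_fun setT (fun w => logB B (X n w)).
  by apply: measurable_funM => //; exact: measurableT_comp (@measurable_ln R) (mX n).
have eqP_pr D n : 0 < D -> P [set w | significand B (X n w) <= D] =
    (pr P [set w | fracpart (logB B (X n w)) <= logB B D])%:E.
  move=> D0; rewrite -prE; last exact: measurable_fracpart_le.
  by congr (P _); apply/seteqP; split=> w /=; rewrite significand_le.
split=> [H s /andP[s0 s1]|H D /andP[D1 DB]].
  (* [D] is [B] to the power [s], so [[0, 1]] corresponds to [[1, B]]. *)
  pose D := expR (s * ln B).
  have logD : logB B D = s by rewrite /logB expRK mulfK// gt_eqF.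
  have := H D; rewrite logD.
  under eq_fun do rewrite eqP_pr ?expR_gt0// logD.
  have DB : 1 <= D <= B.
    rewrite -expR0 ler_expR mulr_ge0 ?(ltW lnB)//=.
    by rewrite -[leRHS]lnK ?posrE// ler_expR ler_piMl// ltW.
  by move=> /(_ DB) /fine_cvgP[].
have D0 : 0 < D by rewrite (lt_le_trans _ D1).
under eq_fun do rewrite eqP_pr//.
apply: cvg_EFin; first exact: nearW.
apply: H; rewrite /logB; apply/andP; split.
  by apply: divr_ge0; [exact: ln_ge0|exact: ltW].
by rewrite ler_pdivrMr// mul1r ler_ln ?posrE.
Qed.

End BenfordModOne.

(** * Side products of the boxes *)

Section SideProducts.
Context {R : realType}.

Lemma ln_prod_gt0 (I : Type) (r : seq I) (Q : pred I) (F : I -> R) :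
  (forall i, 0 < F i) ->
  ln (\prod_(i <- r | Q i) F i) = \sum_(i <- r | Q i) ln (F i).
Proof.
move=> F0; rewrite -[RHS]expRK expR_sum; congr ln.
by apply: eq_bigr => i _; rewrite lnK ?posrE.
Qed.

(** The maximum is attained at some [a0], and separation makes every other term at most [expR (- K)]
    times [g a0]. The sum is then at most [g a0 * (1 + #|A| * expR (- K))], and
    [ln (1 + x) <= x]. *)
Lemma ln_sum_sub_ln_max (A : finType) (Q : pred A) (g : A -> R) (K : R) (a1 : A) :
  Q a1 -> (forall a, 0 < g a) ->
  (forall a b, Q a -> Q b -> a != b -> K < `|ln (g a) - ln (g b)|) ->
  0 <= ln (\sum_(a | Q a) g a) - ln (\big[Num.max/0]_(a | Q a) g a)
    <= #|A|%:R * expR (- K).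
Proof.
move=> Qa1 g0 sep.
have [a0 Qa0 maxE] := eq_bigmax _ _ _ Qa1 (fun a (_ : Q a) => ltW (g0 a)).
have le_a0 a : Q a -> g a <= g a0.
  by move=> Qa; rewrite -maxE; exact: le_bigmax_cond.
rewrite maxE.
have far a : Q a && (a != a0) -> g a <= g a0 * expR (- K).
  move=> /andP[Qa aa0]; rewrite -ler_ln ?posrE ?mulr_gt0 ?expR_gt0//.
  rewrite lnM ?posrE ?expR_gt0// expRK.
  have := sep _ _ Qa Qa0 aa0; have := le_a0 _ Qa; rewrite -ler_ln ?posrE// => h.
  by rewrite ler0_norm ?subr_le0//; lra.
have le_sum : \sum_(a | Q a) g a <= g a0 * (1 + #|A|%:R * expR (- K)).
  rewrite (bigD1 a0)//= mulrDr mulr1 lerD2l.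
  apply: (le_trans (ler_sum _ far)); rewrite sumr_const [leRHS]mulrCA -[leLHS]mulr_natl.
  by rewrite ler_wpM2r ?ler_nat ?max_card// mulr_ge0 ?expR_ge0// ltW.
have ge_sum : g a0 <= \sum_(a | Q a) g a.
  by rewrite (bigD1 a0)//= lerDl sumr_ge0// => a _; rewrite ltW.
have s0 : 0 < \sum_(a | Q a) g a by exact: lt_le_trans ge_sum.
have C0 : 0 <= #|A|%:R * expR (- K) by rewrite mulr_ge0// expR_ge0.
have C1 : 0 < 1 + #|A|%:R * expR (- K) by rewrite ltr_wpDr.
rewrite subr_ge0 ler_ln ?posrE// ge_sum/= lerBlDl.
apply: (@le_trans _ _ (ln (g a0 * (1 + #|A|%:R * expR (- K))))).
  by rewrite ler_ln ?posrE ?mulr_gt0.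
by rewrite lnM ?posrE// lerD2l le_ln1Dx// (lt_le_trans _ C0).
Qed.

Context {d} {T : measurableType d} (P : probability T R) {m : nat}.
Context (c : 'I_m -> R) (X : 'I_m -> nat -> T -> R) (f : 'I_m -> R -> R).
Hypothesis c0 : forall i, 0 < c i.
Hypothesis mX : forall i t, measurable_fun setT (X i t).
Hypothesis X0 : forall i t w, 0 < X i t w.
Hypothesis indX : mutually_independent P (fun k : 'I_m * nat => X k.1 k.2).
Hypothesis mf : forall i, measurable_fun (`]0%R, 1%R[%classic : set R) (f i).
Hypothesis f0 : forall i x, 0 < x < 1 -> 0 < f i x.
Hypothesis Xf : forall i t (A : set R), measurable A -> P (X i t @^-1` A) =
  (\int[@lebesgue_measure R]_(x in A `&` (`]0%R, 1%R[%classic : set R)) (f i x)%:E)%E.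

Let S n w i := c i * \prod_(t < n) X i t w.

Lemma side_gt0 n w i : 0 < S n w i.
Proof. by rewrite mulr_gt0// prodr_gt0. Qed.

Lemma measurable_side n i : measurable_fun setT (fun w => S n w i).
Proof.
by apply: measurable_funM => //; apply: measurable_prod => t _; exact: mX.
Qed.

Lemma measurable_side_prod n (J : {set 'I_m}) :
  measurable_fun setT (fun w => \prod_(i in J) S n w i).
Proof.
rewrite (_ : (fun w => _) = fun w => \prod_i (if i \in J then S n w i else 1)).
  apply: measurable_prod => i _; case: (i \in J) => //; exact: measurable_side.
by apply/funext => w; rewrite -big_mkcond.
Qed.

(** Distinct sets of equal size leave some [i0] in [J1] but not in [J2]. The logarithms of the cuts
    of side [i0] then enter the difference with coefficient 1 and form a walk independent of all the
    rest. *)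
Lemma side_prods_separate (J1 J2 : {set 'I_m}) (K e : R) :
  J1 != J2 -> #|J1| = #|J2| -> 0 < K -> 0 < e ->
  \forall n \near \oo, pr P [set w | `|ln (\prod_(i in J1) S n w i)
                                      - ln (\prod_(i in J2) S n w i)| <= K] <= e.
Proof.
move=> J12 cardJ K0 e0.
have [i0 i01 i02] : exists2 i0, i0 \in J1 & i0 \notin J2.
  apply/subsetPn; apply: contra J12 => J12.
  by rewrite eqEcard J12 cardJ leqnn.
pose k (t : nat) := (i0, t).
have k_inj : injective k by move=> ? ? [].
pose Y (j : 'I_m * nat) := X j.1 j.2.
have mY j : measurable_fun setT (Y j) by exact: mX.
have K20 : 0 < K *+ 2 by rewrite mulrn_wgt0.
have cells l : exists2 p : R, 0 < p &
    forall t, p <= pr P ((fun w => ln (Y (k t) w)) @^-1` cell (K *+ 2) l).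
  by have := log_cell_prob l K20 (mX i0) (X0 i0) (mf i0) (f0 i0) (Xf i0).
have near_walk := concentrated_walk_small mY indX k_inj K20 cells e0.
near=> n.
pose l i w := ln (c i) + \sum_(t < n) ln (X i t w).
(* Everything except the cuts of side [i0]: of that side only the constant [ln (c i0)] is kept. *)
pose rest w := \sum_i (if i == i0 then ln (c i0) else
  (if i \in J1 then l i w else 0) - (if i \in J2 then l i w else 0)).
have mrest t : measurable_off Y (k t) rest.
  apply: measurable_sum => i; case: eqVneq => [_|ii0]; first exact: measurable_cst.
  have ml : measurable_off Y (k t) (l i).
    apply: measurable_funD; first exact: measurable_cst.
    apply: measurable_sum => s; apply: (measurableT_comp (@measurable_ln R)).
    by apply: (@measurable_off_coord _ _ _ _ Y (k t) (i, val s));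
      apply: contra ii0 => /eqP[->].
  by apply: measurable_funB; [case: (i \in J1)|case: (i \in J2)] => //; exact: measurable_cst.
have lnS J w : ln (\prod_(i in J) S n w i) = \sum_(i in J) l i w.
  rewrite ln_prod_gt0; last by move=> i; exact: side_gt0.
  apply: eq_bigr => i _; rewrite lnM ?posrE ?prodr_gt0//.
  by rewrite ln_prod_gt0.
have diffE w : ln (\prod_(i in J1) S n w i) - ln (\prod_(i in J2) S n w i) =
    rest w + \sum_(t < n) ln (Y (k t) w).
  rewrite !lnS big_mkcond [X in _ - X]big_mkcond -sumrB.
  rewrite (bigD1 i0)//= [rest w](bigD1 i0)//= i01 (negbTE i02) eqxx subr0 /l.
  rewrite -!addrA [X in _ + X]addrC; congr (_ + (_ + _)).
  by apply: eq_bigr => i /negbTE ->.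
have conc : forall Z, (forall t, measurable_off Y (k t) Z) ->
    concentrated P (K *+ 2) (fun w => Z w + \sum_(t < n) ln (Y (k t) w)) e.
  by near: n; exact: near_walk.
(* The window of length [2 * K] starting at [- K] is [[- K, K]]. *)
apply: le_trans (conc rest mrest (- K)).
rewrite le_eqVlt; apply/orP; left; apply/eqP; congr (pr P _).
apply/seteqP; split=> w /=; rewrite in_itv/= diffE ler_norml mulr2n addrA addNr add0r//.
Unshelve. all: by end_near.
Qed.

End SideProducts.

(** * Transfer from the largest product to the d-volume *)

(* X i t is the proportion cut P_i^{(t+1)}; side lengths of box B_n are
   S_i^{(n)} = (b0 i - a0 i) * prod_{t < n} X i t. *)
Theorem theorem1p6 (dT : measure_display) (T : measurableType dT) (R : realType)
  (P : probability T R) (B : R) (m d : nat)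
  (a0 b0 : 'I_m -> R) (X : 'I_m -> nat -> T -> R) (f : 'I_m -> R -> R)
  (mu sigma2 : R) :
  1 < B -> (1 <= d)%N -> (d <= m)%N ->
  (forall i, a0 i < b0 i) ->
  (forall i t, measurable_fun setT (X i t)) ->
  (forall i t w, 0 < X i t w < 1) ->
  mutually_independent P (fun k : 'I_m * nat => X k.1 k.2) ->
  (forall i, measurable_fun (`]0%R, 1%R[%classic : set R) (f i)) ->
  (forall i x, 0 < x < 1 -> 0 < f i x) ->
  (forall i t (A : set R), measurable A ->
     P (X i t @^-1` A) =
     (\int[@lebesgue_measure R]_(x in A `&` (`]0%R, 1%R[%classic : set R)) (f i x)%:E)%E) ->
  (forall i t, P.-integrable setT
     (fun w => (`|logB B (X i t w)| ^+ 3)%:E)) ->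
  (forall i t, ('E_P[fun w => logB B (X i t w)])%E = mu%:E) ->
  (forall i t, 'V_P[fun w => logB B (X i t w)] = sigma2%:E) ->
  0 < sigma2 ->
  let S := fun n w i => (b0 i - a0 i) * \prod_(t < n) X i t w in
  strong_Benford P B (fun n w => max_prod_d d (S n w)) ->
  strong_Benford P B (fun n w => vol_d d (S n w)).
Proof.
move=> B1 _ dm ab mX X01 indX mf f0 Xf _ _ _ _ S benM.
have lnB : 0 < ln B by exact: ln_gt0.
pose c i := b0 i - a0 i.
have c0 i : 0 < c i by rewrite subr_gt0.
have X0 i t w : 0 < X i t w by have /andP[] := X01 i t w.
pose Q (J : {set 'I_m}) := #|J| == d.
pose g n w (J : {set 'I_m}) := \prod_(i in J) S n w i.
have g0 n w J : 0 < g n w J.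
  by apply: prodr_gt0 => i _; exact: (side_gt0 c0 X0).
have mg n J : measurable_fun setT (fun w => g n w J).
  exact: (measurable_side_prod c mX).
have [J0 QJ0] : exists J0, Q J0.
  exists [set widen_ord dm i | i : 'I_d]%SET; rewrite /Q card_imset ?card_ord//.
  by move=> i j [] /val_inj.
pose M n w := max_prod_d d (S n w).
pose V n w := vol_d d (S n w).
have M0 n w : 0 < M n w.
  by apply: lt_le_trans (g0 n w J0) _; exact: le_bigmax_cond.
have mM n : measurable_fun setT (M n).
  rewrite /M /max_prod_d; elim: (index_enum _) => [|J r IH].
    by under eq_fun do rewrite big_nil; exact: measurable_cst.
  under eq_fun do rewrite big_cons.
  by case: (#|J| == d) => //; apply: measurable_maxr => //; exact: mg.
have sum0 n w : 0 < \sum_(J | Q J) g n w J.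
  rewrite (bigD1 J0)//= ltr_pwDl//; apply: sumr_ge0 => J _; exact: ltW.
have V0 n w : 0 < V n w by apply: mulr_gt0; [exact: exprn_gt0|exact: sum0].
have mV n : measurable_fun setT (V n).
  apply: measurable_funM => //.
  under eq_fun do rewrite big_mkcond.
  by apply: measurable_sum => J; case: (#|J| == d) => //; exact: mg.
have mlog (Y : nat -> T -> R) : (forall n, measurable_fun setT (Y n)) ->
    forall n, measurable_fun setT (fun w => logB B (Y n w)).
  move=> mY n; apply: measurable_funM => //.
  exact: (measurableT_comp (@measurable_ln R) (mY n)).
apply/(strong_Benford_uniform P B1 V0 mV).
move/(strong_Benford_uniform P B1 M0 mM): benM.
(* The factor [2 ^+ (m - d)] of the volume contributes the constant shift; the remaining difference
   compares the sum of the products with their maximum. *)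
apply: (@uniform_mod1_perturb _ _ _ P _ _ (logB B (2 ^+ (m - d)))); [exact: mlog..|].
move=> dl e dl0 e0.
pose C : R := #|{set 'I_m}|%:R.
have C0 : 0 < C by rewrite ltr0n; apply/card_gt0P; exists J0.
(* Chosen so that [expR K >= C / (dl * ln B)], which is [CK]; the summand 1 makes [K] positive. *)
pose K := 1 + `|ln (C / (dl * ln B))|.
have K0 : 0 < K by rewrite ltr_pwDl.
have CK : C * expR (- K) / ln B <= dl.
  rewrite ler_pdivrMr// expRN ler_pdivrMr ?expR_gt0// mulrC -ler_pdivrMr ?mulr_gt0//.
  rewrite -[leLHS]lnK ?posrE ?divr_gt0 ?mulr_gt0// ler_expR.
  by rewrite (le_trans (ler_norm _))// lerDr.
pose near_tie n (J : {set 'I_m} * {set 'I_m}) :=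
  [set w | `|ln (g n w J.1) - ln (g n w J.2)| <= K].
pose E (J : {set 'I_m} * {set 'I_m}) := [&& Q J.1, Q J.2 & J.1 != J.2].
pose N : R := #|{: {set 'I_m} * {set 'I_m}}|%:R.
have N0 : 0 < N by rewrite ltr0n; apply/card_gt0P; exists (J0, J0).
have mtie n J : measurable (near_tie n J).
  have mlng J' : measurable_fun setT (fun w => ln (g n w J')).
    exact: (measurableT_comp (@measurable_ln R) (mg n J')).
  rewrite (_ : near_tie n J =
      (fun w => ln (g n w J.1) - ln (g n w J.2)) @^-1` `[- K, K]).
    by apply: measurable_preimage_itv; exact: measurable_funB.
  by apply/seteqP; split=> w; rewrite /near_tie/= in_itv/= ler_norml.
have tie_small : \forall n \near \oo, forall J, E J -> pr P (near_tie n J) <= e / N.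
  apply: filter_forall => J; have [EJ|] := boolP (E J); last first.
    by move=> _; exact: nearW.
  have /and3P[/eqP c1 /eqP c2 J12] := EJ.
  have := side_prods_separate c0 mX X0 indX mf f0 Xf J12
    (etrans c1 (esym c2)) K0 (divr_gt0 e0 N0).
  by apply: filterS => n ? _.
near=> n.
have le_tie : forall J, E J -> pr P (near_tie n J) <= e / N by near: n.
(* Some two products are within a factor [expR K] of each other. There are at most [N] pairs, each
   of probability at most [e / N]. *)
pose bad := \big[setU/set0]_(J | E J) near_tie n J.
have mbad : measurable bad by exact: bigsetU_measurable.
exists (~` bad); split; first exact: measurableC.
  rewrite setCK; apply: (le_trans (pr_bigU_le P _ _ (mtie n))).
  apply: (le_trans (ler_sum _ le_tie)); rewrite sumr_const -[leLHS]mulr_natl.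
  rewrite mulrCA; apply: ler_piMr; first exact: ltW.
  by rewrite ler_pdivrMr// mul1r ler_nat max_card.
move=> w wgood.
have sep J1 J2 : Q J1 -> Q J2 -> J1 != J2 -> K < `|ln (g n w J1) - ln (g n w J2)|.
  move=> Q1 Q2 J12; rewrite ltNge; apply/negP => tie; apply: wgood.
  rewrite /bad -bigcup_seq_cond; exists (J1, J2) => //=.
  by rewrite mem_index_enum /E/= Q1 Q2.
have /andP[h1 h2] := ln_sum_sub_ln_max QJ0 (g0 n w) sep.
have -> : logB B (V n w) - logB B (M n w) - logB B (2 ^+ (m - d)) =
    (ln (\sum_(J | Q J) g n w J) - ln (\big[Num.max/0]_(J | Q J) g n w J)) / ln B.
  rewrite /logB /V /vol_d lnM ?posrE ?exprn_gt0//; last exact: sum0.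
  by rewrite /M /max_prod_d /g /Q; ring.
rewrite divr_ge0 ?(ltW lnB)//=; apply: le_trans CK.
by rewrite ler_pM2r ?invr_gt0.
Unshelve. all: by end_near.
Qed.
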